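(* For every integer $k\ge 0$, $|\mathcal{U}_{2k+1}(312,2431)|=\frac{1}{2k+1}\binom{3k}{k}$.
   Context: West's stack-sorting map $s$ is defined recursively on finite sequences of distinct positive integers: $s$ sends the empty sequence to itself, and if $\pi$ is a nonempty such sequence with largest entry $n$, writing $\pi=LnR$ one sets $s(\pi)=s(L)s(R)n$. A permutation $\pi\in S_n$ (one-line notation) is uniquely sorted if exactly one permutation $\sigma\in S_n$ satisfies $s(\sigma)=\pi$. Let $\mathcal{U}_n$ be the set of uniquely sorted permutations in $S_n$. A permutation $\pi$ contains a pattern $\tau\in S_m$ if some subsequence of $\pi$ of length $m$ has its entries in the same relative order as $\tau$; otherwise $\pi$ avoids $\tau$. $\mathcal{U}_{n}(\tau^{(1)},\dots,\tau^{(\ell)})$ denotes the set of permutations in $\mathcal{U}_n$ avoiding all of $\tau^{(1)},\dots,\tau^{(\ell)}$. *)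

(* Defs.v *)
From mathcomp Require Import all_boot all_fingroup.

Set Implicit Arguments.
Unset Strict Implicit.
Unset Printing Implicit Defensive.

(* [m] is recursion fuel; [m = size w] is always enough. *)
Fixpoint stack_sort_rec (m : nat) (w : seq nat) : seq nat :=
  if m is m'.+1 then
    if w is [::] then [::] else
    let n := \max_(x <- w) x in
    let L := take (index n w) w in
    let R := drop (index n w).+1 w in
    rcons (stack_sort_rec m' L ++ stack_sort_rec m' R) n
  else [::].

Definition stack_sort (w : seq nat) : seq nat := stack_sort_rec (size w) w.

(* One-line notation, with entries 1, ..., n. *)
Definition word (n : nat) (p : 'S_n) : seq nat :=
  [seq (val (p i)).+1 | i <- enum 'I_n].

Definition uniquely_sorted (n : nat) : {set 'S_n} :=
  [set p : 'S_n | #|[set q : 'S_n | stack_sort (word q) == word p]| == 1].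

Definition same_relative_order (u t : seq nat) : bool :=
  (size u == size t) &&
  [forall i : 'I_(size t), forall j : 'I_(size t),
     (nth 0 u i < nth 0 u j) == (nth 0 t i < nth 0 t j)].

Definition contains_pattern (w t : seq nat) : bool :=
  [exists b : (size w).-tuple bool, same_relative_order (mask b w) t].

Definition uniquely_sorted_avoiding (n : nat) (ts : seq (seq nat)) :
    {set 'S_n} :=
  [set p in uniquely_sorted n | all (fun t => ~~ contains_pattern (word p) t) ts].

Lemma stack_sort_rec_fuel (m : nat) (w : seq nat) :
  size w <= m -> stack_sort_rec m w = stack_sort w.
Proof.
rewrite /stack_sort; have [k] := ubnP (size w).
elim: k m w => // k IH [|m] [|x w] // lt_wk le_wm.
rewrite /stack_sort -[size (x :: w)]/(size w).+1.
set w' := x :: w; rewrite /=; set n := \max_(_ <- _) _.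
set i := index n w'.
have in_n : n \in w'.
  have maxin : forall (a : nat) l, \max_(y <- a :: l) y \in a :: l.
    move=> a l; elim: l a => [|b l IHl] a; first by rewrite big_seq1 mem_head.
    rewrite big_cons; case: leqP => _; last exact: mem_head.
    by rewrite in_cons IHl orbT.
  exact: maxin.
have lt_i : i < (size w).+1 by rewrite -[(size w).+1]/(size w') index_mem.
have sL : size (take i w') <= size w.
  by rewrite size_takel // ltnW.
have sR : size (drop i.+1 w') <= size w.
  by rewrite size_drop /= subSS leq_subr.
have IHu u p : size u <= size w -> size u <= p ->
    stack_sort_rec p u = stack_sort_rec (size u) u.
  by move=> le_uw; apply: IH; apply: leq_ltn_trans le_uw lt_wk.
by rewrite !(IHu _ m) ?(IHu _ (size w)) // ?(leq_trans sL) ?(leq_trans sR).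
Qed.

Lemma stack_sort_nil : stack_sort [::] = [::].
Proof. by []. Qed.

Lemma stack_sort_max (L R : seq nat) (n : nat) :
    all (fun x => x < n) L -> all (fun x => x < n) R ->
  stack_sort (L ++ n :: R) = stack_sort L ++ stack_sort R ++ [:: n].
Proof.
move=> /allP ltL /allP ltR; set w := L ++ n :: R.
have max_w : \max_(x <- w) x = n.
  apply/eqP; rewrite eqn_leq; apply/andP; split.
    apply/bigmax_leqP_seq => x; rewrite mem_cat in_cons.
    by case/or3P=> [/ltL/ltnW|/eqP->|/ltR/ltnW].
  by apply: (@leq_bigmax_seq _ w predT id n) => //; rewrite mem_cat mem_head orbT.
have idx : index n w = size L.
  rewrite index_cat ifN ?index_head /= ?eqxx ?addn0 //.
  by apply/negP=> /ltL; rewrite ltnn.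
have size_w : size w = (size L + size R).+1 by rewrite size_cat addnS.
have w_cons : exists x w', w = x :: w'.
  by rewrite /w; case: (L) => [|x L']; [exists n, R|exists x, (L' ++ n :: R)].
rewrite /stack_sort size_w /=; case: w_cons => x [w' Ew].
rewrite {1}Ew max_w idx /w take_size_cat // -cat_rcons drop_size_cat ?size_rcons //.
by rewrite !stack_sort_rec_fuel ?leq_addr ?leq_addl // -cats1 -catA.
Qed.

Lemma contains_patternP (w t : seq nat) :
  reflect (exists2 u, subseq u w & same_relative_order u t)
          (contains_pattern w t).
Proof.
apply: (iffP existsP) => [[b tb]|[u /subseqP[b sb ->] tb]].
  by exists (mask b w); first exact: mask_subseq.
by exists (Tuple (introT eqP sb)).
Qed.

(* Main.v *)
(* Idea.  Write D for a descent and X for any other letter of a word.  A sorted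
   word w = s(L) s(R) n has fewer D's than X's in each nonempty suffix, where the
   first letter of the suffix counts as an X ([ballot]), and its preimage is
   unique exactly when the whole word has one more X than D's ([tight]).
   Conversely a 312-avoiding ballot permutation is sorted, because in it every
   ascent top is a left-to-right maximum.

   Let x be the first letter of a permutation p avoiding 312 and 2431.
   Prepending a new first letter v to p, raising the letters >= v by one, again
   avoids both patterns iff v is 1, x or x + 1, and only x + 1 creates a descent.
   A word of height h (number of X's minus number of D's, minus one) thus has
   children of heights h + 1 (v = 1, or v = x when x > 1) and h - 1 (v = x + 1).
   If N(k, r) denotes the number of forests of r ternary trees with k nodes, the
   recurrence N(k, r + 1) = N(k, r) + N(k - 1, r + 3) shows that such a word has
   N(k, 2h + 1 + [x > 1]) tight descendants with h + 2k more letters.  Starting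
   from the word 1 this gives N(k, 1). *)
Require Import Defs.
From mathcomp Require Import all_boot all_order all_algebra all_fingroup.
From mathcomp Require Import zify.

Set Implicit Arguments.
Unset Strict Implicit.
Unset Printing Implicit Defensive.

Import GRing.Theory Num.Theory.

(** * Descents and the ballot condition on suffixes *)

Fixpoint desc (s : seq nat) : nat :=
  if s is x :: s' then (head x s' < x) + desc s' else 0.

(** With a [D] at each descent bottom, a suffix [s] has [desc s] letters [D] and [size s - desc s]
    letters [X]; the inequality says that the [X]'s are more numerous. *)
Fixpoint ballot (s : seq nat) : bool :=
  if s is _ :: s' then (2 * desc s < size s) && ballot s' else true.

Definition tight (s : seq nat) : bool := size s == 2 * desc s + 1.

(** The default [last x s1] makes the junction term vanish when [s2] is empty. *)
Lemma desc_cat x s1 s2 :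
  desc ((x :: s1) ++ s2) =
  desc (x :: s1) + (head (last x s1) s2 < last x s1) + desc s2.
Proof.
elim: s1 x => [|y s1 IH] x; first by rewrite /= ltnn.
by rewrite cat_cons /= -/(_ ++ _) in IH *; rewrite IH; lia.
Qed.

Lemma desc_cat_le (s1 s2 : seq nat) : desc (s1 ++ s2) <= desc s1 + desc s2 + (s2 != [::]).
Proof.
case: s1 => [|x s1]; first by rewrite add0n leq_addr.
rewrite desc_cat; case: s2 => [|y s2] /=; last by case: (_ < last _ _); lia.
by rewrite ltnn; lia.
Qed.

Lemma desc_rcons s n : all (fun x => x < n) s -> desc (rcons s n) = desc s.
Proof.
case: s => [|x s] /allP lt_n; first by rewrite /= ltnn.
rewrite -cats1 desc_cat [desc [:: n]]/= ltnn !addn0 [head _ _]/=.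
by rewrite ltnNge ltnW ?addn0 // lt_n // mem_last.
Qed.

Lemma ballot_cat s1 s2 : ballot (s1 ++ s2) -> ballot s2.
Proof. by elim: s1 => //= x s1 IH /andP[_ /IH]. Qed.

Lemma ballot_desc (s : seq nat) : s != [::] -> ballot s -> 2 * desc s < size s.
Proof. by case: s => // x s _ /andP[]. Qed.

(** Each nonempty factor has a surplus of at least one; the junction costs at most one descent, and
    the final [n] adds a letter without a descent. *)
Lemma ballot_cat_rcons (A B : seq nat) n :
  all (fun x => x < n) (A ++ B) -> ballot A -> ballot B ->
  ballot (rcons (A ++ B) n).
Proof.
elim: A => [|x A IH] ltn bA bB.
  elim: B ltn bB => [|x B IH] ltn bB; first by rewrite /= ltnn.
  have := desc_rcons ltn; case/andP: ltn bB => _ ltn /andP[dB bB].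
  rewrite cat0s rcons_cons => dr.
  rewrite /ballot -/ballot dr IH // andbT.
  by move: dB; rewrite /= size_rcons; lia.
have := desc_rcons ltn; case/andP: ltn bA => _ ltn /andP[dA bA].
rewrite cat_cons rcons_cons => dr.
rewrite /ballot -/ballot dr IH // andbT /= size_rcons size_cat.
have := desc_cat_le (x :: A) B; have := @ballot_desc B; rewrite bB.
case: B {IH bB ltn dr} => [|y B]; rewrite /= in dA *; first by lia.
by move=> /(_ isT isT); lia.
Qed.

(** * Images of the stack-sorting map *)

Definition stack_sorted (w : seq nat) : Prop :=
  exists2 q : seq nat, uniq q & stack_sort q = w.

Lemma split_max (w : seq nat) : uniq w -> w != [::] ->
  exists L n R, [/\ w = L ++ n :: R, all (fun x => x < n) L
                  & all (fun x => x < n) R].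
Proof.
case: w => // x w uw _; set n := \max_(y <- x :: w) y.
have le_n y : y \in x :: w -> y <= n.
  by move=> yw; apply: (@leq_bigmax_seq _ (x :: w) predT id).
have nw : n \in x :: w.
  rewrite /n {uw n le_n}; elim: w x => [|y w IH] x; first by rewrite big_seq1 inE.
  rewrite big_cons; case: leqP => _; last exact: mem_head.
  by rewrite in_cons IH orbT.
case/splitPr: nw uw le_n => L R; rewrite cat_uniq /= => /and3P[_ nL /andP[nR _]] le_n.
exists L, n, R; split=> //; apply/allP=> y yI.
  rewrite ltn_neqAle le_n ?mem_cat ?yI // andbT; apply/eqP=> y_n.
  by move: nL; rewrite -y_n yI.
rewrite ltn_neqAle le_n ?mem_cat ?inE ?yI ?orbT // andbT; apply/eqP=> y_n.
by move: nR; rewrite -y_n yI.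
Qed.

Lemma perm_stack_sort (q : seq nat) : uniq q -> perm_eq (stack_sort q) q.
Proof.
have [m] := ubnP (size q); elim: m q => // m IH q lt_m uq.
have [->//|q0] := eqVneq q [::].
have [L [n [R [Eq ltL ltR]]]] := split_max uq q0.
move: uq lt_m; rewrite Eq cat_uniq size_cat /= => /and3P[uL _ /andP[_ uR]] lt_m.
rewrite stack_sort_max // perm_cat ?IH //; first by clear -lt_m; lia.
rewrite perm_catC /= perm_cons IH //; lia.
Qed.

Lemma size_stack_sort (q : seq nat) : uniq q -> size (stack_sort q) = size q.
Proof. by move/perm_stack_sort/perm_size. Qed.

Lemma all_stack_sort (P : pred nat) (q : seq nat) :
  uniq q -> all P (stack_sort q) = all P q.
Proof. by move/perm_stack_sort/perm_all=> ->. Qed.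

Variant preimage_spec (q w : seq nat) : Prop :=
| PreimageNil of q = [::] & w = [::]
| PreimageMax L n R of q = L ++ n :: R & uniq L & uniq R
    & w = rcons (stack_sort L ++ stack_sort R) n
    & all (fun x => x < n) (stack_sort L ++ stack_sort R).

Lemma preimageP (q w : seq nat) :
  uniq q -> stack_sort q = w -> preimage_spec q w.
Proof.
move=> uq Ew; have [Eq|q0] := eqVneq q [::].
  by left=> //; rewrite -Ew Eq.
have [L [n [R [Eq ltL ltR]]]] := split_max uq q0.
move: uq Ew; rewrite Eq cat_uniq => /and3P[uL _ /andP[_ uR]].
rewrite stack_sort_max // => Ew; right with L n R => //.
  by rewrite -Ew -cats1 catA.
by rewrite all_cat !all_stack_sort // ltL.
Qed.

Lemma stack_sort_rcons (L R : seq nat) n : uniq L -> uniq R ->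
    all (fun x => x < n) (stack_sort L ++ stack_sort R) ->
  stack_sort (L ++ n :: R) = rcons (stack_sort L ++ stack_sort R) n.
Proof.
move=> uL uR; rewrite all_cat !all_stack_sort // => /andP[ltL ltR].
by rewrite stack_sort_max // -cats1 catA.
Qed.

Lemma uniq_preimage (L R : seq nat) n :
    uniq L -> uniq R -> uniq (stack_sort L ++ stack_sort R) ->
    all (fun x => x < n) (stack_sort L ++ stack_sort R) ->
  uniq (L ++ n :: R).
Proof.
move=> uL uR uLR ltn; rewrite -cat1s uniq_catCA cat1s cons_uniq.
have pLR : perm_eq (stack_sort L ++ stack_sort R) (L ++ R).
  by rewrite perm_cat ?perm_stack_sort.
rewrite -(perm_uniq pLR) uLR andbT -(perm_mem pLR).
by apply/negP=> /(allP ltn); rewrite ltnn.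
Qed.

Lemma stack_sorted_ballot w : stack_sorted w -> ballot w.
Proof.
case=> q; have [m] := ubnP (size q); elim: m q w => // m IH q w lt_m uq Ew.
case: (preimageP uq Ew) => [_ -> //|L n R Eq uL uR -> ltn].
move: lt_m; rewrite Eq size_cat /= => lt_m.
apply: ballot_cat_rcons ltn _ _; first by apply: (IH L) => //; clear -lt_m; lia.
by apply: (IH R) => //; clear -lt_m; lia.
Qed.

Lemma stack_sorted_cat_rcons (A B : seq nat) n :
    stack_sorted A -> stack_sorted B -> uniq (A ++ B) ->
    all (fun x => x < n) (A ++ B) ->
  stack_sorted (rcons (A ++ B) n).
Proof.
move=> [L uL <-] [R uR <-] uLR ltn.
exists (L ++ n :: R); first exact: uniq_preimage.
exact: stack_sort_rcons.
Qed.

Lemma stack_sorted_rcons (A : seq nat) n :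
  stack_sorted A -> uniq A -> all (fun x => x < n) A -> stack_sorted (rcons A n).
Proof.
move=> sA uA ltn; rewrite -[A]cats0.
by apply: stack_sorted_cat_rcons; rewrite ?cats0 //; exists [::].
Qed.

(* If [B = rcons (B1 ++ B2) m], glue [A] to the first nonempty factor of [B]. *)
Lemma stack_sorted_cat (A B : seq nat) :
    stack_sorted A -> stack_sorted B -> uniq (A ++ B) -> B != [::] ->
    all (fun x => x < head 0 B) A ->
  stack_sorted (A ++ B).
Proof.
move=> sA [q uq Ew]; have [m] := ubnP (size q).
elim: m q B uq Ew => // m IH q B uq Ew lt_m uAB B0 ltA.
case: (preimageP uq Ew) => [_ B_nil|L n R Eq uL uR EB ltn]; first by rewrite B_nil in B0.
move: lt_m; rewrite Eq size_cat /= => lt_m.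
have head_le : head 0 B <= n.
  rewrite EB; case: (stack_sort L ++ stack_sort R) ltn => [|y s] //=.
  by case/andP => /ltnW.
have ltAn : all (fun x => x < n) A.
  by apply: sub_all ltA => x lt_x; apply: leq_trans lt_x head_le.
have sR : stack_sorted (stack_sort R) by exists R.
move: uAB; rewrite EB -cats1 !catA cats1 rcons_uniq => /andP[_ uALR].
have ltALR : all (fun x => x < n) ((A ++ stack_sort L) ++ stack_sort R).
  by rewrite -catA all_cat ltAn.
have [L0|L0] := eqVneq (stack_sort L) [::]; last first.
  apply: stack_sorted_cat_rcons => //.
  apply: (IH L) => //; first by clear -lt_m; lia.
    by move: uALR; rewrite cat_uniq => /andP[].
  by move: ltA; rewrite EB; case: (stack_sort L) L0.
rewrite L0 cats0 in ltALR uALR *.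
have [R0|R0] := eqVneq (stack_sort R) [::].
  rewrite R0 cats0 in ltALR uALR *; exact: stack_sorted_rcons.
apply: stack_sorted_rcons => //; apply: (IH R) => //; first by clear -lt_m; lia.
by move: ltA; rewrite EB L0; case: (stack_sort R) R0.
Qed.

(** * Tightness and uniqueness of the preimage *)

Definition two_preimages (w : seq nat) : Prop :=
  exists q1 q2 : seq nat, [/\ uniq q1, uniq q2, stack_sort q1 = w, stack_sort q2 = w
                  & q1 <> q2].

(** The largest letter may be put either after or before a preimage of [A]. *)
Lemma two_preimages_rcons (A : seq nat) n :
    stack_sorted A -> A != [::] -> uniq A -> all (fun x => x < n) A ->
  two_preimages (rcons A n).
Proof.
move=> [q uq Eq] A0 uA ltn; exists (q ++ [:: n]), ([::] ++ n :: q).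
split; rewrite ?stack_sort_rcons ?uniq_preimage ?cats0 ?Eq //.
case: q uq Eq => [|x q] uq Eq; first by rewrite -Eq in A0.
move=> [xn _]; move/allP: ltn => /(_ x).
by rewrite -Eq (perm_mem (perm_stack_sort uq)) xn mem_head ltnn => /(_ isT).
Qed.

(** A loose factor yields two preimages by induction, and an empty one by [two_preimages_rcons]. If
    both factors are nonempty and tight, a loose [w] has no descent at their junction; then their
    concatenation is itself sorted, and [two_preimages_rcons] applies to it. *)
Lemma two_preimages_loose w :
  stack_sorted w -> uniq w -> w != [::] -> ~~ tight w -> two_preimages w.
Proof.
case=> q; have [m] := ubnP (size q); elim: m q w => // m IH q w lt_m uq Ew uw w0 tw.
case: (preimageP uq Ew) => [_ w_nil|L n R Eq uL uR E ltn]; first by rewrite w_nil in w0.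
move: lt_m; rewrite Eq size_cat /= => lt_m.
have sL : stack_sorted (stack_sort L) by exists L.
have sR : stack_sorted (stack_sort R) by exists R.
move: uw; rewrite E rcons_uniq => /andP[_ uLR].
have [L0|L0] := eqVneq (stack_sort L) [::].
  rewrite L0 !cat0s in ltn uLR E *; have [R0|R0] := eqVneq (stack_sort R) [::].
    by move: tw; rewrite E R0 /tight /= ltnn.
  exact: two_preimages_rcons.
have [R0|R0] := eqVneq (stack_sort R) [::].
  rewrite R0 !cats0 in ltn uLR E *; exact: two_preimages_rcons.
move: (uLR); rewrite cat_uniq => /and3P[usL _ usR].
have [tL|tL] := boolP (tight (stack_sort L)); last first.
  have [|q1 [q2 [u1 u2 E1 E2 q12]]] := IH L (stack_sort L) _ uL erefl usL L0 tL.
    by clear -lt_m; lia.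
  exists (q1 ++ n :: R), (q2 ++ n :: R).
  split; rewrite ?stack_sort_rcons ?uniq_preimage ?E1 ?E2 //.
  move/(congr1 rev); rewrite !rev_cat => /eqP.
  by rewrite eqseq_cat // => /andP[_ /eqP/(can_inj revK)].
have [tR|tR] := boolP (tight (stack_sort R)); last first.
  have [|q1 [q2 [u1 u2 E1 E2 q12]]] := IH R (stack_sort R) _ uR erefl usR R0 tR.
    by clear -lt_m; lia.
  exists (L ++ n :: q1), (L ++ n :: q2).
  split; rewrite ?stack_sort_rcons ?uniq_preimage ?E1 ?E2 //.
  by move/eqP; rewrite eqseq_cat // => /andP[_ /eqP[]].
apply: two_preimages_rcons => //; last by case: (stack_sort L) L0.
apply: stack_sorted_cat => //.
case: (preimageP uL erefl) => [L_nil _|L1 a L2 _ _ _ EL ltL].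
  by rewrite L_nil in L0.
(* The last letter [a] of the sorted left factor is also its maximum, so it alone has to be
   compared. *)
suff lt_a : a < head 0 (stack_sort R).
  rewrite EL all_rcons lt_a /=; apply: sub_all ltL => x lt_x; exact: ltn_trans lt_a.
have a_in : a \in stack_sort L by rewrite EL mem_rcons mem_head.
have R_in : head 0 (stack_sort R) \in stack_sort R.
  by case: (stack_sort R) R0 => // *; apply: mem_head.
rewrite ltn_neqAle; apply/andP; split.
  apply/eqP=> aR; move: uLR; rewrite cat_uniq => /and3P[_ /hasPn/(_ _ R_in)].
  by rewrite /= -aR a_in.
rewrite leqNgt; apply/negP => gt_a.
move: tw tL tR; rewrite E /tight size_rcons desc_rcons // size_cat.
case EsL : (stack_sort L) L0 => [|x s] // _; rewrite desc_cat.
have -> : last x s = a by rewrite -[last x s]/(last a (x :: s)) -EsL EL last_rcons.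
have -> : head a (stack_sort R) = head 0 (stack_sort R) by case: (stack_sort R) R0.
by rewrite gt_a; clear; lia.
Qed.

(* If two splits [A1 ++ B1 = A2 ++ B2] of the same word had different lengths,
   the suffix formed by the last letter of [A2] and [B2] would violate ballot. *)
Lemma tight_split_size (A1 B1 A2 B2 : seq nat) :
    A1 ++ B1 = A2 ++ B2 -> A2 != [::] -> ballot B1 ->
    size B2 + 1 = 2 * desc B2 + 2 -> head 0 B2 < last 0 A2 ->
  size A2 <= size A1.
Proof.
move=> E A2_0 bB1 tB2 lt_h; rewrite leqNgt; apply/negP=> lt_A.
have := congr1 (drop (size A1)) E; rewrite drop_size_cat // drop_cat lt_A.
case EC : (drop (size A1) A2) => [|x C].
  by move/(congr1 size): EC; rewrite size_drop /=; lia.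
have EA2 : A2 = (take (size A1) A2 ++ x :: C) by rewrite -EC cat_take_drop.
case/lastP: C EA2 {EC} => [|C y] EA2 EB1.
  move: bB1; rewrite EB1 /= => /andP[].
  move: lt_h; rewrite EA2 last_cat /=.
  by case: B2 tB2 {E EB1} => [|b B2] //= t2 lt_bx; rewrite lt_bx; clear -t2; lia.
move: bB1; rewrite EB1 -rcons_cons -cats1 -catA => /ballot_cat /= /andP[].
move: lt_h; rewrite EA2 last_cat /= last_rcons.
by case: B2 tB2 {E EB1} => [|b B2] //= t2 lt_by; rewrite lt_by; clear -t2; lia.
Qed.

(** Equality must hold throughout the count of [ballot_cat_rcons]: both surpluses are exactly one
    and the junction is a descent. *)
Lemma tight_factors (A B : seq nat) n :
    stack_sorted A -> stack_sorted B -> all (fun x => x < n) (A ++ B) ->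
    tight (rcons (A ++ B) n) -> A ++ B != [::] ->
  [/\ A != [::], B != [::], tight A, tight B & head 0 B < last 0 A].
Proof.
move=> /stack_sorted_ballot bA /stack_sorted_ballot bB ltn.
rewrite /tight size_rcons desc_rcons // => + AB0.
have [A0|A0] := eqVneq A [::].
  by move: AB0; rewrite A0 cat0s => /ballot_desc/(_ bB) dB /eqP T; exfalso; clear -dB T; lia.
have [B0|B0] := eqVneq B [::].
  by move: AB0; rewrite B0 cats0 => /ballot_desc/(_ bA) dA /eqP T; exfalso; clear -dA T; lia.
have := ballot_desc B0 bB; have := ballot_desc A0 bA.
case: A {bA ltn AB0} A0 => // a A _; rewrite desc_cat size_cat.
have -> : head (last a A) B = head 0 B by case: B B0 {bB}.
rewrite [last 0 _]/=; move=> dA dB /eqP; case: (ltnP (head 0 B) (last a A)) => _ T; split=> //;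
  by clear -dA dB T; lia.
Qed.

(** The maximum is the last letter of [w], and [tight_split_size], used in both directions, forces
    the cut between the two factors. These are tight again, so induction applies. *)
Lemma tight_unique_preimage w (q1 q2 : seq nat) :
  uniq q1 -> uniq q2 -> stack_sort q1 = w -> stack_sort q2 = w -> tight w ->
  q1 = q2.
Proof.
have [m] := ubnP (size q1); elim: m w q1 q2 => // m IH w q1 q2 lt_m u1 u2 E1 E2 tw.
case: (preimageP u1 E1) => [_ w_nil|L1 n1 R1 Eq1 uL1 uR1 Ew1 lt1]; first by rewrite w_nil in tw.
case: (preimageP u2 E2) => [_ w_nil|L2 n2 R2 Eq2 uL2 uR2 Ew2 lt2]; first by rewrite w_nil in tw.
have /rcons_inj[ELR En] := etrans (esym Ew1) Ew2.
move: lt_m; rewrite Eq1 Eq2 size_cat /= -En in lt2 * => lt_m.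
have sL1 : stack_sorted (stack_sort L1) by exists L1.
have sR1 : stack_sorted (stack_sort R1) by exists R1.
have sL2 : stack_sorted (stack_sort L2) by exists L2.
have sR2 : stack_sorted (stack_sort R2) by exists R2.
have [LR0|LR0] := eqVneq (stack_sort L1 ++ stack_sort R1) [::].
  move/eqP: LR0 => LR0; have := LR0; rewrite ELR; move: LR0.
  rewrite -!size_eq0 !size_cat !size_stack_sort //.
  by rewrite !addn_eq0 !size_eq0 => /andP[/eqP-> /eqP->] /andP[/eqP-> /eqP->].
have [A10 B10 tA1 tB1 lth1] : [/\ stack_sort L1 != [::], stack_sort R1 != [::],
    tight (stack_sort L1), tight (stack_sort R1)
    & head 0 (stack_sort R1) < last 0 (stack_sort L1)].
  by apply: (@tight_factors _ _ n1) => //; rewrite -Ew1.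
have [A20 B20 tA2 tB2 lth2] : [/\ stack_sort L2 != [::], stack_sort R2 != [::],
    tight (stack_sort L2), tight (stack_sort R2)
    & head 0 (stack_sort R2) < last 0 (stack_sort L2)].
  by apply: (@tight_factors _ _ n1) => //; rewrite -?ELR // -Ew1.
have Esz : size (stack_sort L1) = size (stack_sort L2).
  apply/eqP; rewrite eqn_leq (tight_split_size (esym ELR)) ?(tight_split_size ELR) //;
    rewrite ?stack_sorted_ballot //; [move/eqP: tB2 | move/eqP: tB1]; clear; lia.
move/eqP: ELR; rewrite eqseq_cat // => /andP[/eqP EL /eqP ER].
rewrite (IH _ L1 L2 _ uL1 uL2 erefl (esym EL)) //; last by clear -lt_m; lia.
by rewrite (IH _ R1 R2 _ uR1 uR2 erefl (esym ER)) //; clear -lt_m; lia.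
Qed.

(** * Pattern avoidance, and sortedness of 312-avoiding ballot words *)

Definition has312 (w : seq nat) : Prop :=
  exists a b c, [/\ subseq [:: a; b; c] w, b < c & c < a].

Definition has2431 (w : seq nat) : Prop :=
  exists a b c d, [/\ subseq [:: a; b; c; d] w, d < a, a < c & c < b].

Lemma has312P w : reflect (has312 w) (contains_pattern w [:: 3; 1; 2]).
Proof.
apply: (iffP (contains_patternP _ _)) => [[u uw] | [a [b [c [uw lt_bc lt_ca]]]]].
  case/andP; case: u uw => [|a [|b [|c [|]]]] // uw _ /forallP /= H.
  have o1 : 1 < 3 by []. have o2 : 2 < 3 by [].
  have /forallP/(_ (Ordinal o2))/= := H (Ordinal o1); rewrite eqb_id => lt_bc.
  have /forallP/(_ (@Ordinal 3 0 isT))/= := H (Ordinal o2); rewrite eqb_id => lt_ca.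
  by exists a, b, c.
exists [:: a; b; c] => //; apply/andP; split=> //.
apply/forallP=> -[[|[|[|i]]] //= hi]; apply/forallP=> -[[|[|[|j]]] //= hj];
  clear -lt_bc lt_ca; apply/eqP; lia.
Qed.

Lemma has2431P w : reflect (has2431 w) (contains_pattern w [:: 2; 4; 3; 1]).
Proof.
apply: (iffP (contains_patternP _ _)) => [[u uw] | [a [b [c [d [uw lt_da lt_ac lt_cb]]]]]].
  case/andP; case: u uw => [|a [|b [|c [|d [|]]]]] // uw _ /forallP /= H.
  have o0 : 0 < 4 by []. have o1 : 1 < 4 by []. have o2 : 2 < 4 by []. have o3 : 3 < 4 by [].
  have /forallP/(_ (Ordinal o0))/= := H (Ordinal o3); rewrite eqb_id => lt_da.
  have /forallP/(_ (Ordinal o2))/= := H (Ordinal o0); rewrite eqb_id => lt_ac.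
  have /forallP/(_ (Ordinal o1))/= := H (Ordinal o2); rewrite eqb_id => lt_cb.
  by exists a, b, c, d.
exists [:: a; b; c; d] => //; apply/andP; split=> //.
apply/forallP=> -[[|[|[|[|i]]]] //= hi]; apply/forallP=> -[[|[|[|[|j]]]] //= hj];
  clear -lt_da lt_ac lt_cb; apply/eqP; lia.
Qed.

Lemma has312_subseq u w : subseq u w -> has312 u -> has312 w.
Proof. by move=> uw [a [b [c [su ? ?]]]]; exists a, b, c; rewrite (subseq_trans su). Qed.

Lemma shortest_non_ballot s : ~~ ballot s ->
  exists A c B, [/\ s = A ++ c :: B, ballot B & size B < 2 * desc (c :: B)].
Proof.
elim: s => // x s IH; have [bs|/IH[A [c [B [-> bB dB]]]] _] := boolP (ballot s).
  by rewrite [ballot _]/= bs andbT -leqNgt => d; exists [::], x, s.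
by exists (x :: A), c, B.
Qed.

(* The last letter is an ascent top, hence the maximum of [w]; removing it, cut
   at the shortest suffix violating ballot. *)
Lemma ballot_stack_sorted w :
  uniq w -> ~ has312 w -> ballot w -> stack_sorted w.
Proof.
have [m] := ubnP (size w); elim: m w => // m IH w.
case/lastP: w => [|w n]; first by exists [::].
rewrite size_rcons rcons_uniq => lt_m /andP[nw uw] av bw.
have ltn : all (fun x => x < n) w.
  case/lastP: w uw nw av bw {lt_m} => // w y uw nw av bw.
  (* The ballot condition on the suffix [[:: y; n]] forbids a descent. A letter [z > n] would then
     form 312 with [y] and [n]. *)
  have lt_yn : y < n.
    move: bw nw; rewrite -!cats1 -catA => /ballot_cat /= /andP[d _].
    rewrite mem_cat inE negb_or => /andP[_ /eqP ny].
    by move: d ny; clear; case: (ltnP n y) => /=; lia.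
  rewrite all_rcons lt_yn /=; apply/allP=> z zw.
  rewrite ltnNge leq_eqVlt negb_or; apply/andP; split.
    by apply/eqP=> nz; move: nw; rewrite nz mem_rcons inE zw orbT.
  apply/negP=> lt_nz; apply: av; exists z, y, n; split=> //.
  by rewrite -!cats1 -catA -[[:: z; y; n]]/([:: z] ++ [:: y; n]) cat_subseq // sub1seq.
have [bw'|/shortest_non_ballot[A [c [B [Ew bB dB]]]]] := boolP (ballot w).
  apply: stack_sorted_rcons => //; apply: IH => //.
  by apply: contra_not av; apply: has312_subseq; exact: subseq_rcons.
have {bw}bw : forall A1 A2, rcons A c = A1 ++ A2 ->
    A2 != [::] -> 2 * desc (A2 ++ B) < size A2 + size B + 1.
  move=> A1 A2 E A20; move: bw.
  have Ew' : w = A1 ++ A2 ++ B by rewrite catA -E cat_rcons.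
  rewrite Ew' rcons_cat => /ballot_cat/ballot_desc; rewrite desc_rcons.
    by rewrite size_rcons size_cat addn1; apply; case: (A2) A20.
  by move: ltn; rewrite Ew' all_cat => /andP[].
have B0 : B != [::] by case: (B) dB; rewrite //= ltnn.
have := bw A [:: c]; rewrite cats1 => /(_ erefl isT) dcB.
have := ballot_desc B0 bB => dB'.
(* The suffix [c :: B] fails the ballot condition, but [B] satisfies it and so does [c :: B]
   followed by [n]: hence [c] tops a descent and [B] is tight. *)
have [lt_cB tB] : head c B < c /\ size B + 1 = 2 * desc B + 2.
  move: dB dcB dB'; rewrite /=; case: (ltnP (head c B) c) => _; clear; first lia.
  by move=> *; exfalso; lia.
have Ew' : w = rcons A c ++ B by rewrite cat_rcons.
rewrite Ew' in uw ltn av lt_m *.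
have sub s : subseq s (rcons A c ++ B) -> ~ has312 s.
  move=> ss; apply: contra_not av; apply: has312_subseq.
  exact: (subseq_trans ss (subseq_rcons _ _)).
move: (uw); rewrite cat_uniq => /and3P[uA _ uB].
apply: stack_sorted_cat_rcons => //; apply: IH => //.
- by move: lt_m; move: B0; rewrite size_cat -size_eq0; clear; lia.
- by apply: sub; apply: prefix_subseq.
(* For each suffix [A2], subtracting the tight [B] and the descent at the junction from the bound
   [bw] leaves the ballot inequality for [A2]. *)
- have: forall A1 A2, rcons A c = A1 ++ A2 -> ballot A2; last by move/(_ [::] (rcons A c) erefl).
  move=> A1 A2; elim: A2 A1 => // a A2 IHA A1 E.
  apply/andP; split; last by apply: (IHA (rcons A1 a)); rewrite cat_rcons.
  have := bw _ _ E isT; rewrite desc_cat.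
  have -> : last a A2 = c.
    by have := congr1 (last 0) E; rewrite last_rcons last_cat.
  have -> : head c B < c by [].
  by move: tB; clear; lia.
- by move: lt_m; rewrite size_cat size_rcons; clear; lia.
- by apply: sub; apply: suffix_subseq.
Qed.

(** * From permutations to words *)

Lemma wordE n (p : 'S_n) : word p = [seq (nat_of_ord (p i)).+1 | i : 'I_n <- enum 'I_n].
Proof. by []. Qed.

Lemma size_word n (p : 'S_n) : size (word p) = n.
Proof. by rewrite wordE size_map size_enum_ord. Qed.

Lemma nth_word n (p : 'S_n) (i : 'I_n) : nth 0 (word p) i = (p i).+1.
Proof. by rewrite wordE (nth_map i) ?size_enum_ord // nth_ord_enum. Qed.

Lemma word_inj n : injective (@word n).
Proof.
move=> p q E; apply/permP=> i; apply/val_inj/succn_inj.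
by rewrite /= -!nth_word E.
Qed.

Lemma perm_iota_subset (w : seq nat) n : uniq w -> size w = n ->
  (forall x, x \in w -> 0 < x <= n) -> perm_eq w (iota 1 n).
Proof.
move=> uw szw sub; have [||_ E] := @uniq_min_size _ w (iota 1 n) uw.
- by move=> x /sub; rewrite mem_iota add1n ltnS.
- by rewrite size_iota szw.
exact: uniq_perm uw (iota_uniq _ _) E.
Qed.

Lemma perm_word n (p : 'S_n) : perm_eq (word p) (iota 1 n).
Proof.
apply: perm_iota_subset.
- by rewrite wordE map_inj_uniq ?enum_uniq // => i j [/val_inj/perm_inj].
- exact: size_word.
by move=> x; rewrite wordE => /mapP[i _ ->]; rewrite /= ltn_ord.
Qed.

Lemma word_surj n (w : seq nat) :
  perm_eq w (iota 1 n) -> exists p : 'S_n, word p = w.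
Proof.
move=> pw; have szw : size w = n by rewrite (perm_size pw) size_iota.
have uw : uniq w by rewrite (perm_uniq pw) iota_uniq.
have lt_f (i : 'I_n) : (nth 0 w i).-1 < n /\ 0 < nth 0 w i.
  have: nth 0 w i \in w by rewrite mem_nth ?szw.
  by rewrite (perm_mem pw) mem_iota; clear; lia.
pose f i := Ordinal (lt_f i).1.
have f_inj : injective f.
  move=> i j [E]; apply/val_inj/eqP; rewrite -[_ == _](@nth_uniq _ 0 w i j) ?szw ?ltn_ord //.
  have [_ gt0i] := lt_f i; have [_ gt0j] := lt_f j.
  by rewrite -(prednK gt0i) -(prednK gt0j) E.
exists (perm f_inj); apply: (@eq_from_nth _ 0) => [|i]; rewrite size_word ?szw //.
move=> lt_i; rewrite (nth_word _ (Ordinal lt_i)) permE /= prednK //.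
by have [] := lt_f (Ordinal lt_i).
Qed.

Lemma word_uniq n (p : 'S_n) : uniq (word p).
Proof. by rewrite (perm_uniq (perm_word p)) iota_uniq. Qed.

Lemma preimage_word n (p : 'S_n) (q : seq nat) :
  uniq q -> stack_sort q = word p -> exists r : 'S_n, word r = q.
Proof.
move=> uq E; apply: word_surj; apply: perm_trans (perm_word p).
by rewrite -E perm_sym perm_stack_sort.
Qed.

(** The size is a successor because the empty word has exactly one preimage without being tight. *)
Lemma uniquely_sortedE n (p : 'S_n.+1) : ~ has312 (word p) ->
  (p \in uniquely_sorted n.+1) = ballot (word p) && tight (word p).
Proof.
move=> av; rewrite inE; apply/cards1P/andP => [[q Eq]|[bp tp]].
  have : q \in [set q] by rewrite inE.
  rewrite -Eq inE => /eqP Ep.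
  have sp : stack_sorted (word p) by exists (word q); rewrite ?word_uniq.
  split; first exact: stack_sorted_ballot.
  apply/idPn => /(two_preimages_loose sp (word_uniq p)) [|q1 [q2 [u1 u2 E1 E2]]].
    by rewrite -size_eq0 (perm_size (perm_word p)) size_iota.
  have [r1 Er1] := preimage_word u1 E1; have [r2 Er2] := preimage_word u2 E2.
  have : r1 \in [set q] by rewrite -Eq inE Er1 E1.
  have : r2 \in [set q] by rewrite -Eq inE Er2 E2.
  by rewrite !inE -Er1 -Er2 => /eqP-> /eqP->.
have [q uq E] := ballot_stack_sorted (word_uniq p) av bp.
have [r Er] := preimage_word uq E; exists r; apply/setP=> r'; rewrite !inE.
apply/eqP/eqP=> [E'|->]; last by rewrite Er.
by apply/word_inj; rewrite Er; apply: tight_unique_preimage E' E tp; rewrite ?word_uniq.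
Qed.

(** * The generating tree: prepending a first letter *)

Definition avoids (p : seq nat) : Prop := ~ has312 p /\ ~ has2431 p.

(** This inverts deleting the first letter of a permutation and standardizing the rest. *)
Definition ins (v : nat) (p : seq nat) : seq nat := v :: map (bump v) p.

Lemma ins_inj v1 v2 p1 p2 : ins v1 p1 = ins v2 p2 -> v1 = v2 /\ p1 = p2.
Proof. by case=> <- /(inj_map (can_inj (bumpK v1)))->. Qed.

Lemma mem_perm_iota (w : seq nat) n x : perm_eq w (iota 1 n) ->
  (x \in w) = (0 < x <= n).
Proof. by move/perm_mem->; rewrite mem_iota add1n ltnS. Qed.

Lemma perm_ins v p n : perm_eq p (iota 1 n) -> 0 < v <= n.+1 ->
  perm_eq (ins v p) (iota 1 n.+1).
Proof.
move=> pp lev; apply: perm_iota_subset.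
- rewrite /= (map_inj_uniq (can_inj (bumpK v))) (perm_uniq pp) iota_uniq andbT.
  by apply/mapP=> -[z _ Ev]; have := neq_bump v z; rewrite -Ev eqxx.
- by rewrite /= size_map (perm_size pp) size_iota.
move=> x; rewrite inE => /predU1P[->//|/mapP[z]].
by rewrite (mem_perm_iota _ pp) /bump => + ->; move: lev; clear; lia.
Qed.

Lemma perm_unins v t n : perm_eq (v :: t) (iota 1 n.+1) ->
  exists2 p, v :: t = ins v p & perm_eq p (iota 1 n).
Proof.
move=> pt; have /andP[vt ut] : uniq (v :: t) by rewrite (perm_uniq pt) iota_uniq.
have E : map (bump v) (map (unbump v) t) = t.
  rewrite -map_comp map_id_in // => z zt /=; apply: unbumpK.
  by rewrite inE; apply: contraNneq vt => <-.
exists (map (unbump v) t); first by rewrite /ins E.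
apply: perm_iota_subset.
- by rewrite -(map_inj_uniq (can_inj (bumpK v))) E.
- by have := perm_size pt; rewrite size_map size_iota => -[].
move=> x /mapP[z zt ->].
have zv : z != v by apply: contraNneq vt => <-.
have := mem_perm_iota z pt; have := mem_perm_iota v pt.
rewrite !inE eqxx zt orbT /unbump => /esym lev /esym lez.
by move: zv lev lez; clear; lia.
Qed.

Lemma subseq_map_inv (f : nat -> nat) u s : subseq u (map f s) ->
  exists2 u', subseq u' s & u = map f u'.
Proof.
case/subseqP=> m sz ->; exists (mask m s); first exact: mask_subseq.
by rewrite map_mask.
Qed.

Lemma ltn_bump v a b : (bump v a < bump v b) = (a < b).
Proof. by rewrite !ltnNge leq_bump2. Qed.

Lemma avoids_unins v p : avoids (ins v p) -> avoids p.
Proof.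
move=> [av1 av2]; split.
  move=> [a [b [c [su bc ca]]]]; apply: av1.
  exists (bump v a), (bump v b), (bump v c); rewrite !ltn_bump; split=> //.
  apply: subseq_trans (subseq_cons _ v).
  exact: (map_subseq (bump v) su).
move=> [a [b [c [d [su da ac cb]]]]]; apply: av2.
exists (bump v a), (bump v b), (bump v c), (bump v d); rewrite !ltn_bump; split=> //.
apply: subseq_trans (subseq_cons _ v).
exact: (map_subseq (bump v) su).
Qed.

Lemma subseq_cons2 (a v : nat) u s : subseq (a :: u) (v :: s) ->
  a = v /\ subseq u s \/ subseq (a :: u) s.
Proof. by rewrite /=; case: eqP => [->|_] su; [left|right]. Qed.

Lemma avoids_ins v x t : uniq (x :: t) -> all (leq 1) (x :: t) ->
  v \in [:: 1; x; x.+1] -> avoids (x :: t) -> avoids (ins v (x :: t)).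
Proof.
move=> /andP[xt _] pos vI [av1 av2].
have posb b u : subseq u t -> b \in u -> 0 < b /\ b != x.
  move=> /mem_subseq su /su bt; split.
    by move/allP: pos => /(_ b); rewrite inE bt orbT; apply.
  by apply: contraNneq xt => <-.
have avt : avoids (map (bump v) (x :: t)).
  split.
    move=> [a [b [c [/subseq_map_inv[[|a' [|b' [|c' [|]]]] //= su [-> -> ->]]]]]].
    by rewrite !ltn_bump => bc ca; apply: av1; exists a', b', c'.
  move=> [a [b [c [d [/subseq_map_inv[[|a' [|b' [|c' [|d' [|]]]]] //= su [-> -> -> ->]]]]]]].
  by rewrite !ltn_bump => da ac cb; apply: av2; exists a', b', c', d'.
have x_gt0 : 0 < x by case/andP: pos.
split.
  move=> [a [b [c [/subseq_cons2[[-> su]|su] bc ca]]]]; last first.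
    by case: avt => + _; apply; exists a, b, c.
  case: (subseq_cons2 su) => [[Eb /subseq_map_inv[[|c' [|]] //= sc [Ec]]]|].
    have [c0 cx] := posb c' _ sc (mem_head _ _).
    by move: vI bc ca cx c0 x_gt0; rewrite Eb Ec !inE /bump; clear; lia.
  case/subseq_map_inv=> [[|b' [|c' [|]]] //= sbc [Eb Ec]].
  have [c0 cx] : 0 < c' /\ c' != x by apply: posb sbc _; rewrite !inE eqxx orbT.
  have [b0 bx] : 0 < b' /\ b' != x by apply: posb sbc _; rewrite !inE eqxx.
  apply: av1; exists x, b', c'; split; first by rewrite /= eqxx.
    by rewrite -(ltn_bump v) -Eb -Ec.
  by move: vI bc ca cx c0 b0 x_gt0; rewrite Eb Ec !inE /bump; clear; lia.
move=> [a [b [c [d [/subseq_cons2[[-> su]|su] da ac cb]]]]]; last first.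
  by case: avt => _; apply; exists a, b, c, d.
case: (subseq_cons2 su) => [[Eb /subseq_map_inv[[|c' [|d' [|]]] //= sc [Ec Ed]]]|].
  have [c0 cx] := posb c' _ sc (mem_head _ _).
  have [d0 dx] : 0 < d' /\ d' != x by apply: posb sc _; rewrite !inE eqxx orbT.
  by move: vI da ac cb cx c0 d0 x_gt0; rewrite Eb Ec Ed !inE /bump; clear; lia.
case/subseq_map_inv=> [[|b' [|c' [|d' [|]]]] //= sbc [Eb Ec Ed]].
have [c0 cx] : 0 < c' /\ c' != x by apply: posb sbc _; rewrite !inE eqxx orbT.
have [d0 dx] : 0 < d' /\ d' != x by apply: posb sbc _; rewrite !inE eqxx !orbT.
apply: av2; exists x, b', c', d'; split; first by rewrite /= eqxx.
- by move: vI da ac cb cx c0 d0 dx x_gt0; rewrite Eb Ec Ed !inE /bump; clear; lia.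
- by move: vI da ac cb cx c0 d0 dx x_gt0; rewrite Eb Ec Ed !inE /bump; clear; lia.
by rewrite -(ltn_bump v) -Eb -Ec.
Qed.

Lemma subseq2_or (a b : nat) s : a \in s -> b \in s -> a != b ->
  subseq [:: a; b] s \/ subseq [:: b; a] s.
Proof.
move=> /splitPr[s1 s2]; rewrite mem_cat inE => /or3P[b1|/eqP->|b2] ab.
- right; rewrite -[[:: b; a]]/([:: b] ++ [:: a]) cat_subseq ?sub1seq //.
  exact: mem_head.
- by rewrite eqxx in ab.
left; rewrite -[[:: a; b]]/([::] ++ [:: a; b]) cat_subseq ?sub0seq //=.
by rewrite eqxx sub1seq.
Qed.

(** If [v > x.+1], then [v, x, v.-1] is a 312. If [1 < v < x], the old head becomes [x.+1], and the
    order of the letters [1] and [v.+1] decides between the 312 [x.+1, 1, v.+1] and the 2431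
    [v, x.+1, v.+1, 1]. *)
Lemma avoids_ins_head v x t n : perm_eq (x :: t) (iota 1 n) -> 0 < v <= n.+1 ->
  avoids (ins v (x :: t)) -> v \in [:: 1; x; x.+1].
Proof.
move=> pt lev [av1 av2]; rewrite !inE; apply/idPn; rewrite !negb_or => /and3P[v1 vx vx1].
have mem_t z : 0 < z <= n -> z != x -> z \in t.
  by rewrite -(mem_perm_iota z pt) inE => /predU1P[->|//]; rewrite eqxx.
have lex : 0 < x <= n by rewrite -(mem_perm_iota x pt) mem_head.
have [gt_v|le_v] := ltnP x v.
  apply: av1; exists v, x, v.-1; rewrite /= eqxx.
  have -> : bump v x = x by move: gt_v; clear; rewrite /bump; lia.
  rewrite eqxx sub1seq; split; [|by move: lev vx1 gt_v; clear; lia..].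
  have {1}-> : v.-1 = bump v v.-1 by move: lev; clear; rewrite /bump; lia.
  by rewrite (mem_map (can_inj (bumpK v))) mem_t //; move: lev vx1 gt_v; clear; lia.
have Ex : bump v x = x.+1 by move: le_v; clear; rewrite /bump; lia.
have m1 : 1 \in map (bump v) t.
  have {1}-> : 1 = bump v 1 by move: lev v1; clear; rewrite /bump; lia.
  by rewrite (mem_map (can_inj (bumpK v))) mem_t //; move: lex vx lev le_v v1; clear; lia.
have mv : v.+1 \in map (bump v) t.
  have {1}-> : v.+1 = bump v v by clear; rewrite /bump; lia.
  by rewrite (mem_map (can_inj (bumpK v))) mem_t //; move: lex vx lev le_v v1; clear; lia.
have [|s|s] := @subseq2_or 1 v.+1 _ m1 mv; first by move: lev; clear; lia.
  apply: av1; exists x.+1, 1, v.+1; split; last 2 first.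
  - by move: lev; clear; lia.
  - by move: vx le_v; clear; lia.
  apply: subseq_trans (subseq_cons _ v); by rewrite /= Ex eqxx.
apply: av2; exists v, x.+1, v.+1, 1; split; first by rewrite /= Ex !eqxx.
- by move: lev v1; clear; lia.
- by [].
by move: vx le_v; clear; lia.
Qed.

(** [undup] merges the first two choices when [p] starts with 1. *)
Definition new_heads (p : seq nat) : seq nat := undup [:: 1; head 0 p; (head 0 p).+1].

Definition extend (L : seq (seq nat)) : seq (seq nat) :=
  [seq w <- [seq ins v p | p <- L, v <- new_heads p] | ballot w].

(** The words at depth [n] have [n.+1] letters. Filtering at every depth loses nothing, since
    suffixes of ballot words are ballot. *)
Definition level (n : nat) : seq (seq nat) := iter n extend [:: [:: 1]].

Lemma perm_iota_cons (p : seq nat) n : perm_eq p (iota 1 n.+1) ->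
  exists x t, p = x :: t.
Proof. by case: p => [|x t] /perm_size // _; exists x, t. Qed.

Lemma size_ins v p : size (ins v p) = (size p).+1.
Proof. by rewrite /= size_map. Qed.

Lemma desc_map_bump v s : desc (map (bump v) s) = desc s.
Proof.
elim: s => //= x s ->; case: s => [|y s] /=; first by rewrite !ltnn.
by rewrite ltn_bump.
Qed.

Lemma ballot_map_bump v s : ballot (map (bump v) s) = ballot s.
Proof.
elim: s => // x s IH.
by rewrite map_cons /ballot -/ballot IH -map_cons desc_map_bump size_map.
Qed.

Lemma ballot_ins v p :
  ballot (ins v p) = (2 * desc (ins v p) < (size p).+1) && ballot p.
Proof. by rewrite -(ballot_map_bump v p) -(size_map (bump v) p). Qed.

Lemma mem_level n w : reflect [/\ perm_eq w (iota 1 n.+1), avoids w & ballot w]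
  (w \in level n).
Proof.
elim: n w => [|n IH] w.
  apply: (iffP idP) => [|[pw _ _]].
    rewrite inE => /eqP->; split=> //; split.
      by move=> [a [b [c [/size_subseq]]]].
    by move=> [a [b [c [d [/size_subseq]]]]].
  (* Rewriting one side of [size w = size w] through [pw] gives [size w = 1]. *)
  have /(congr1 size)/= := erefl w; rewrite {2}(perm_size pw).
  case: w pw => [|x [|]] //= pw _; move/perm_mem/(_ 1): pw.
  by rewrite !inE /= => /eqP <-.
rewrite /level iterS -/(level n) mem_filter.
apply: (iffP andP) => [[bw /allpairsPdep[p [v [/IH[pp avp bp] vI Ew]]]]|[pw avw bw]].
  rewrite {}Ew in bw *.
  have [x [t Ep]] := perm_iota_cons pp.
  have {}vI : v \in [:: 1; x; x.+1] by move: vI; rewrite mem_undup Ep.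
  have pos z : z \in p -> 0 < z <= n.+1 by rewrite (mem_perm_iota z pp).
  have posx : 0 < x <= n.+1 by apply: pos; rewrite Ep mem_head.
  split=> //; last first.
    rewrite Ep; apply: avoids_ins; rewrite -?Ep //.
      by rewrite (perm_uniq pp) iota_uniq.
    by apply/allP=> z /pos /andP[].
  apply: perm_ins => //.
  by move: vI posx; rewrite !inE; clear; lia.
split=> //.
case: w pw avw bw => [/perm_size//|v t] pw avw bw.
have lev : 0 < v <= n.+2 by rewrite -(mem_perm_iota v pw) mem_head.
have [p Ep pp] := perm_unins pw; rewrite Ep in pw avw bw *.
have [x [s Exs]] := perm_iota_cons pp.
apply/allpairsPdep; exists p, v; split=> //.
  apply/IH; split=> //; first exact: avoids_unins avw.
  by move: bw; rewrite ballot_ins => /andP[].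
rewrite Exs in pp avw *; rewrite mem_undup; exact: avoids_ins_head pp lev avw.
Qed.

Lemma uniq_level n : uniq (level n).
Proof.
elim: n => // n IH; rewrite /level iterS -/(level n) filter_uniq //.
apply: allpairs_uniq_dep => //; first by move=> p _; apply: undup_uniq.
by move=> [p1 v1] [p2 v2] _ _ /ins_inj /= [-> ->].
Qed.

Lemma card_avoiding n :
  #|uniquely_sorted_avoiding n.+1 [:: [:: 3; 1; 2]; [:: 2; 4; 3; 1]]| =
  count tight (level n).
Proof.
set S := uniquely_sorted_avoiding _ _.
rewrite cardE -(size_map (@word n.+1)) -size_filter; apply: perm_size.
apply: uniq_perm; rewrite ?filter_uniq ?uniq_level //.
  by rewrite map_inj_uniq ?enum_uniq //; apply: word_inj.
have memS p : reflect (tight (word p) /\ word p \in level n) (p \in S).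
  rewrite inE /= andbT; apply: (iffP and3P) => [[Up /has312P a1 /has2431P a2]|[tp /mem_level[_ [a1 a2] bp]]].
    move: Up; rewrite uniquely_sortedE // => /andP[bp tp]; split=> //.
    by apply/mem_level; split=> //; apply: perm_word.
  split; [|exact/has312P|exact/has2431P].
  by rewrite uniquely_sortedE // bp tp.
move=> w; rewrite mem_filter; apply/mapP/andP => [[p pS ->]|[tw lw]].
  by apply/memS; rewrite -mem_enum.
have [/word_surj[p Ew] _ _] := mem_level _ _ lw.
by exists p => //; rewrite mem_enum; apply/memS; rewrite Ew.
Qed.

(** * Ternary forests and binomial coefficients *)

(* [raney k r] counts forests of [r] ternary trees with [k] nodes. *)
Fixpoint raney (k : nat) : nat -> nat :=
  fix raney_k (r : nat) : nat :=
    if r is r'.+1 then raney_k r' + (if k is k'.+1 then raney k' r'.+3 else 0)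
    else k == 0.

Lemma raney0 r : raney 0 r = 1.
Proof. by elim: r => //= r ->. Qed.

(** The first tree is empty, or removing its root leaves three subtrees beside the other [r]
    trees. *)
Lemma raneyS k r : raney k.+1 r.+1 = raney k.+1 r + raney k r.+3.
Proof. by []. Qed.

Lemma raneyS0 k : raney k.+1 0 = 0.
Proof. by []. Qed.

(** With [K = k.+1], this is [raney K r = r / (3K + r) * 'C(3K + r, K)] in a form without division,
    on which Pascal's rule reproduces the recurrence. *)
Lemma raney_bin k r :
  raney k.+1 r + 2 * 'C(3 * k + r + 2, k) = 'C(3 * k + r + 2, k.+1).
Proof.
elim: k r => [|k IHk] r.
  rewrite bin0 bin1; elim: r => [//|r IHr]; rewrite raneyS raney0; lia.
elim: r => [|r IHr].
  (* With no trees the count is 0, so the right-hand binomial must be twice the left-hand one; their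
     ratio is [(2 * k + 4) / (k + 2)]. *)
  have := mul_bin_left (3 * k.+1 + 0 + 2) k.+1.
  rewrite [raney _ 0]/= addn0; set a := 'C(_, _); set b := 'C(_, _).
  have -> : 3 * k.+1 + 2 - k.+1 = k.+2 * 2 by lia.
  by rewrite -mulnA => /eqP; rewrite eqn_pmul2l // => /eqP->.
have := IHk r.+3.
have -> : 3 * k + r.+3 + 2 = 3 * k.+1 + r + 2 by lia.
have -> : 3 * k.+1 + r.+1 + 2 = (3 * k.+1 + r + 2).+1 by lia.
move: IHr; move: (3 * k.+1 + r + 2) => n; rewrite (raneyS k.+1) !binS; lia.
Qed.

Lemma raney1_bin k : (2 * k + 1) * raney k 1 = 'C(3 * k, k).
Proof.
case: k => [|k]; first by rewrite raney0 bin0.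
(* The ratio of the two adjacent binomials eliminates ['C(3 * k.+1, k)]. *)
have := raney_bin k 1; have := mul_bin_left (3 * k.+1) k.
have -> : 3 * k + 1 + 2 = 3 * k.+1 by lia.
have -> : 3 * k.+1 - k = 2 * k + 3 by lia.
move: (raney _ _) 'C(_, _) 'C(_, _) => N b a; nia.
Qed.

(* A word of height [h] whose first letter exceeds 1 iff [b] has this many
   ballot extensions by [m] letters of height 0. *)
Definition completions (m h : nat) (b : bool) : nat :=
  if (h <= m) && ~~ odd (m - h) then raney (m - h)./2 (2 * h + 1 + b) else 0.

(** The three terms belong to the new first letters [x.+1], [1] and [x]. The raney recurrence is
    unfolded once if [b] is false and twice if it is true; at height 0 the missing first term
    matches [raney k.+1 0 = 0]. *)
Lemma completionsS m h b :
  completions m.+1 h b =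
  (if h is h'.+1 then completions m h' true else 0) + completions m h.+1 false +
  (if b then completions m h.+1 true else 0).
Proof.
have vanish h' b' : ~~ ((h' <= m) && ~~ odd (m - h')) -> completions m h' b' = 0.
  by rewrite /completions => /negbTE->.
have compE k h' m' b' : m' = h' + k.*2 -> completions m' h' b' = raney k (2 * h' + 1 + b').
  by move=> ->; rewrite /completions leq_addr addKn odd_double doubleK.
have [/andP[le_h par]|no] := boolP ((h <= m.+1) && ~~ odd (m.+1 - h)); last first.
  rewrite {1}/completions (negbTE no).
  case: h no => [|h] no; rewrite !vanish ?if_same //; move: no; lia.
have [k Ek] : exists k, m.+1 = h + k.*2.
  by exists (m.+1 - h)./2; rewrite halfK (negbTE par) subn0 subnKC.
rewrite (compE k) //; case: k Ek => [|k] Ek.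
  rewrite !(vanish h.+1); [|lia..]; rewrite if_same raney0.
  case: h Ek le_h {par} => [|h] Ek _; first by lia.
  by rewrite (compE 0) ?raney0 //; lia.
rewrite !(compE k h.+1); [|lia..].
have -> : 2 * h + 1 + b = (2 * h + b).+1 by lia.
rewrite raneyS; case: h Ek {le_h par vanish} => [|h] Ek.
  case: b; last by rewrite raneyS0 addn0.
  by rewrite -[2 * 0 + true]/1 (raneyS k 0) raneyS0.
rewrite (compE k.+1 h); last by lia.
have -> : 2 * h.+1 + b = 2 * h + 2 + b by lia.
have -> : 2 * h.+2 + 1 + false = 2 * h + 5 by lia.
have -> : 2 * h.+2 + 1 + true = 2 * h + 6 by lia.
have -> : 2 * h + 1 + true = 2 * h + 2 by lia.
case: b; last by rewrite !addn0 -!addnS.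
by rewrite !addn1 raneyS -!addnS.
Qed.

(** * Counting tight descendants in the tree *)

Definition height (s : seq nat) : nat := size s - (2 * desc s + 1).

Lemma sum_children m x t : 0 < x -> ballot (x :: t) ->
  \sum_(v <- new_heads (x :: t) | ballot (ins v (x :: t)))
    completions m (height (ins v (x :: t))) (1 < v) =
  completions m.+1 (height (x :: t)) (1 < x).
Proof.
move=> x_gt0 bp; have := ballot_desc (isT : x :: t != [::]) bp => db.
have dE v : desc (ins v (x :: t)) = (bump v x < v) + desc (x :: t).
  by rewrite -[desc (x :: t) in RHS](desc_map_bump v).
have bE v : ballot (ins v (x :: t)) =
    (2 * ((bump v x < v) + desc (x :: t)) < (size (x :: t)).+1).
  by rewrite -dE ballot_ins bp andbT.
have asc v : 0 < v <= x -> (ballot (ins v (x :: t)) = true) *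
    (height (ins v (x :: t)) = (height (x :: t)).+1).
  move=> lev; have nlt : (bump v x < v) = false by rewrite /bump; move: lev; clear; lia.
  by rewrite bE /height dE nlt size_ins; move: db; clear; split; lia.
have nlt : bump x.+1 x < x.+1 by rewrite /bump ltnn add0n.
(* The child with a new descent is ballot exactly when its parent has positive height. *)
have desS :
    (if ballot (ins x.+1 (x :: t)) then
       completions m (height (ins x.+1 (x :: t))) (1 < x.+1) else 0) =
    if height (x :: t) is h'.+1 then completions m h' true else 0.
  rewrite bE /height dE nlt (_ : 1 < x.+1 = true) // size_ins.
  move: db; move: (desc (x :: t)) (size (x :: t)) => d s db.
  case: ltnP => cmp.
    by have -> : s - (2 * d + 1) = (s.+1 - (2 * (true + d) + 1)).+1 by lia.
  by have -> : s - (2 * d + 1) = 0 by lia.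
rewrite completionsS -desS /new_heads [head _ _]/=; case: (ltnP 1 x) => lt_x.
  have -> : undup [:: 1; x; x.+1] = [:: 1; x; x.+1].
    by rewrite undup_id //= !inE; move: lt_x; clear; lia.
  rewrite !big_cons big_nil !(asc 1) // !(asc x) ?x_gt0 ?leqnn // lt_x ltnn.
  by case: (ballot _); clear; lia.
have x1 : x = 1 by move: x_gt0 lt_x; clear; lia.
have -> : undup [:: 1; x; x.+1] = [:: 1; x.+1] by rewrite x1.
rewrite !big_cons big_nil !(asc 1) ?x_gt0 // ltnn.
by case: (ballot _); clear; lia.
Qed.

(** Quantifying over [n] lets the induction on [m] peel off the extension nearest to [level n]. At
    [m = 0] a ballot word contributes 1 exactly when its height is 0, which is tightness. *)
Lemma count_tight_level n m : count tight (iter m extend (level n)) =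
  \sum_(p <- level n) completions m (height p) (1 < head 0 p).
Proof.
elim: m n => [|m IH] n.
  rewrite -sum1_count big_mkcond; apply: eq_big_seq => p /mem_level[pp _ bp].
  have p0 : p != [::] by rewrite -size_eq0 (perm_size pp) size_iota.
  move: (ballot_desc p0 bp); rewrite /completions /tight /height leqn0 sub0n andbT raney0.
  by case: eqP => d; case: eqP => // e; move: d e; clear; lia.
rewrite iterSr -[extend (level n)]/(level n.+1) IH.
rewrite -[level n.+1]/(extend (level n)) big_filter big_mkcond big_allpairs_dep big_seq [RHS]big_seq.
apply: eq_bigr => p /mem_level[pp _ bp].
have [x [t Ep]] := perm_iota_cons pp.
have x_gt0 : 0 < x by have := mem_perm_iota x pp; rewrite Ep mem_head => /esym/andP[].
by rewrite -big_mkcond Ep in bp *; rewrite -sum_children.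
Qed.

Lemma card_avoiding_raney k :
  #|uniquely_sorted_avoiding (2 * k).+1 [:: [:: 3; 1; 2]; [:: 2; 4; 3; 1]]| =
  raney k 1.
Proof.
rewrite card_avoiding -[level _]/(iter (2 * k) extend (level 0)) count_tight_level.
rewrite big_seq1 /completions [height _]/= subn0 leq0n mul2n odd_double doubleK.
by [].
Qed.

Local Open Scope ring_scope.

Theorem theorem5p3 (k : nat) :
  (#|uniquely_sorted_avoiding (2 * k + 1) [:: [:: 3; 1; 2]%N; [:: 2; 4; 3; 1]%N]|)%:R
  = 1 / (2 * k + 1)%:R * 'C(3 * k, k)%:R :> rat.
Proof.
rewrite -raney1_bin addn1 card_avoiding_raney natrM mulrA mul1r mulVf ?mul1r //.
by rewrite pnatr_eq0.
Qed.
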